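(* Let an instance of the two-stage adjustable robust problem (AR) (defined in the context) be given with $\mathbf A\mathbf x\ge\mathbf 0$ for every $\mathbf x\in\mathcal X$, and let $(\mathbf x^*,\mathbf y^*,\boldsymbol\alpha^* )$ be an optimal solution of the linear program (LP-AR) defined in the context, with optimal value $z_{\mathrm{LP\text{-}AR}}$. Then there is a feasible affine policy for (AR) with first-stage solution $\mathbf x^*$ whose worst-case cost is at most $z_{\mathrm{LP\text{-}AR}}$.
   Context: Two-stage adjustable robust problem (AR): $$z_{\mathrm{AR}}=\min_{\mathbf x\in\mathcal X}\ \mathbf c^T\mathbf x+\max_{\mathbf h\in\mathcal U}\ \min_{\mathbf y\ge\mathbf 0}\{\mathbf d^T\mathbf y\mid\mathbf A\mathbf x+\mathbf B\mathbf y\ge\mathbf h\},$$ where $\mathbf A\in\mathbb R^{m\times n'}$, $\mathbf B\in\mathbb R_+^{m\times n}$, $\mathbf c\in\mathbb R_+^{n'}$, $\mathbf d\in\mathbb R_+^n$, $\mathcal X\subset\mathbb R_+^{n'}$ is a polyhedral cone, and $\mathcal U=\{\mathbf h\in\mathbb R^m\mid\mathbf h\ge\mathbf 0,\ \mathbf R\mathbf h\le\mathbf r\}$ with $\mathbf R\in\mathbb R_+^{L\times m}$, $\mathbf r\in\mathbb R_+^L$. For $i\in[m]$ let $\mathbf a_i,\mathbf b_i$ be the $i$-th rows of $\mathbf A,\mathbf B$ (as column vectors), $\mathbf R_i$ the $i$-th column of $\mathbf R$, and $$\theta_i=\max\{z_i\mid\mathbf B^T\mathbf z\le\mathbf d,\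 \mathbf z\ge\mathbf 0\},\qquad\gamma_i=\max\{h_i\mid\mathbf R\mathbf h\le\mathbf r,\ \mathbf h\ge\mathbf 0\},$$ which are assumed finite. The linear program (LP-AR) is $$z_{\mathrm{LP\text{-}AR}}=\min_{\mathbf x,\mathbf y,\boldsymbol\alpha}\ \mathbf c^T\mathbf x+\mathbf d^T\mathbf y+\mathbf r^T\boldsymbol\alpha\quad\text{s.t. }\ \theta_i\mathbf a_i^T\mathbf x+\theta_i\mathbf b_i^T\mathbf y+\gamma_i\mathbf R_i^T\boldsymbol\alpha\ge\theta_i\gamma_i\ \ \forall i\in[m],\quad\mathbf x\in\mathcal X,\ \mathbf y\ge\mathbf 0,\ \boldsymbol\alpha\ge\mathbf 0,$$ with $\mathbf y\in\mathbb R^n$, $\boldsymbol\alpha\in\mathbb R^L$. An affine policy consists of a first-stage solution $\mathbf x\in\mathcal X$ and a second-stage affine map $\mathbf y(\mathbf h)=\mathbf M\mathbf h+\mathbf q$ with $\mathbf M\in\mathbb R^{n\times m}$, $\mathbf q\in\mathbb R^n$. It is feasible if $\mathbf y(\mathbf h)\ge\mathbf 0$ and $\mathbf A\mathbf x+\mathbf B\mathbf y(\mathbf h)\ge\mathbf h$ for all $\mathbf h\in\mathcal U$. Its worst-case cost is $\mathbf c^T\mathbf x+\max_{\mathbf h\in\mathcal U}\mathbf d^T\mathbf y(\mathbf h)$. *)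

(* Defs.v *)
From HB Require Import structures.
From mathcomp Require Export all_boot all_order all_algebra.
From mathcomp Require Export boolp classical_sets reals.

Set Implicit Arguments.
Unset Strict Implicit.
Unset Printing Implicit Defensive.

Export Order.TTheory GRing.Theory Num.Theory.

#[global] Open Scope classical_set_scope.
#[global] Open Scope ring_scope.

Section Generic.
Variable R : realType.

Definition mxle (p q : nat) (M N : 'M[R]_(p, q)) : Prop :=
  forall i j, M i j <= N i j.

Definition dotp (p : nat) (u v : 'cV[R]_p) : R := (u^T *m v) 0 0.

(* Finite, attained extrema: [is_max S v] entails that [S] is nonempty and
   bounded above. *)
Definition is_max (S : set R) (v : R) : Prop := S v /\ ubound S v.
Definition is_min (S : set R) (v : R) : Prop := S v /\ lbound S v.

Definition polyhedral_cone (p : nat) (X : set 'cV[R]_p) : Prop :=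
  exists (k : nat) (G : 'M[R]_(k, p)), X = [set x | mxle 0 (G *m x)].

End Generic.

Record ar_instance (R : realType) (m n n' L : nat) := ARInstance {
  ar_A : 'M[R]_(m, n');
  ar_B : 'M[R]_(m, n);
  ar_c : 'cV[R]_n';
  ar_d : 'cV[R]_n;
  ar_X : set 'cV[R]_n';
  ar_R : 'M[R]_(L, m);
  ar_r : 'cV[R]_L;
  ar_B_ge0 : mxle 0 ar_B;
  ar_c_ge0 : mxle 0 ar_c;
  ar_d_ge0 : mxle 0 ar_d;
  ar_X_cone : polyhedral_cone ar_X;
  ar_X_ge0 : forall x, ar_X x -> mxle 0 x;
  ar_R_ge0 : mxle 0 ar_R;
  ar_r_ge0 : mxle 0 ar_r
}.

Section AR.
Variables (R : realType) (m n n' L : nat) (P : ar_instance R m n n' L).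

Definition uncertainty_set : set 'cV[R]_m :=
  [set h | mxle 0 h /\ mxle (ar_R P *m h) (ar_r P)].

Definition dual_set : set 'cV[R]_m :=
  [set z | mxle ((ar_B P)^T *m z) (ar_d P) /\ mxle 0 z].

Definition is_theta (theta : 'I_m -> R) : Prop :=
  forall i, is_max [set z i 0 | z in dual_set] (theta i).

Definition is_gamma (gamma : 'I_m -> R) : Prop :=
  forall i, is_max [set h i 0 | h in uncertainty_set] (gamma i).

Section LPAR.
Variables theta gamma : 'I_m -> R.

Definition lpar_feasible
    (x : 'cV[R]_n') (y : 'cV[R]_n) (alpha : 'cV[R]_L) : Prop :=
  [/\ forall i : 'I_m,
        theta i * gamma i <=
          theta i * dotp (row i (ar_A P))^T x
          + theta i * dotp (row i (ar_B P))^T y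
          + gamma i * dotp (col i (ar_R P)) alpha,
      ar_X P x, mxle 0 y & mxle 0 alpha].

Definition lpar_objective
    (x : 'cV[R]_n') (y : 'cV[R]_n) (alpha : 'cV[R]_L) : R :=
  dotp (ar_c P) x + dotp (ar_d P) y + dotp (ar_r P) alpha.

Definition is_lpar_value (z : R) : Prop :=
  is_min [set z' | exists x y alpha,
            lpar_feasible x y alpha /\ z' = lpar_objective x y alpha] z.

Definition lpar_optimal
    (x : 'cV[R]_n') (y : 'cV[R]_n) (alpha : 'cV[R]_L) : Prop :=
  lpar_feasible x y alpha /\ is_lpar_value (lpar_objective x y alpha).

End LPAR.

Definition affine_map (M : 'M[R]_(n, m)) (q : 'cV[R]_n) (h : 'cV[R]_m) :
  'cV[R]_n := M *m h + q.

Definition affine_feasible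
    (x : 'cV[R]_n') (M : 'M[R]_(n, m)) (q : 'cV[R]_n) : Prop :=
  ar_X P x /\
  forall h, uncertainty_set h ->
    mxle 0 (affine_map M q h) /\
    mxle h (ar_A P *m x + ar_B P *m affine_map M q h).

Definition is_worst_case_cost
    (x : 'cV[R]_n') (M : 'M[R]_(n, m)) (q : 'cV[R]_n) (w : R) : Prop :=
  exists v : R,
    is_max [set dotp (ar_d P) (affine_map M q h) | h in uncertainty_set] v /\
    w = dotp (ar_c P) x + v.

End AR.

(* Main.v *)
Require Import Defs.
From mathcomp Require Import lra ring.

Set Implicit Arguments.
Unset Strict Implicit.
Unset Printing Implicit Defensive.

(** Let [s := A x* + B y*] and, by linear programming duality, pick [v_i >= 0]
    with [B v_i >= e_i] and [d^T v_i <= theta_i].  The policy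
    [y(h) = y* + sum_i beta_i h_i v_i] with
    [beta_i = max(0, 1 - s_i / gamma_i)] works: since [0 <= h_i <= gamma_i] and
    [s_i >= 0], row [i] of [A x* + B y(h)] is at least
    [s_i + beta_i h_i >= h_i]; and the (LP-AR) constraints say
    [beta_i theta_i <= R_i^T alpha*], so the cost of [y(h)] is at most
    [d^T y* + alpha*^T R h <= d^T y* + r^T alpha*].  Both duality and the
    attainment of the worst case follow from Farkas' lemma, which is proved by
    Fourier-Motzkin elimination. *)

(** * Fourier-Motzkin elimination and Farkas' lemma for finite systems *)

Section Farkas.
Variable R : realType.

(** Each [c j < 0] bounds [t] below by [u j / c j], each [c i > 0] bounds it above by [u i / c i].
    The second hypothesis is [u j / c j <= u i / c i] cross-multiplied, so the largest lower bound,
    or failing one the smallest upper bound, works. *)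
Lemma linear_system_1var (I : finType) (c u : I -> R) :
  (forall i, c i = 0 -> 0 <= u i) ->
  (forall i j, 0 < c i -> c j < 0 -> 0 <= c i * u j - c j * u i) ->
  exists t, forall i, c i * t <= u i.
Proof.
move=> u0 upn; case: (pickP (fun j => c j < 0)) => [j0 cj0|noneg].
  case: (@arg_maxP _ _ _ j0 (fun j => c j < 0) (fun j => u j / c j) cj0).
  move=> j cj jmax; exists (u j / c j) => i; case: (ltgtP (c i) 0) => [ci|ci|ci].
  - by rewrite mulrC -ler_ndivrMr //; exact: jmax.
  - rewrite mulrC -ler_pdivlMr // ler_ndivrMr // mulrAC ler_pdivrMr //.
    by have := upn _ _ ci cj; lra.
  - by rewrite ci mul0r u0.
case: (pickP (fun j => 0 < c j)) => [j0 cj0|nopos].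
  case: (@arg_minP _ _ _ j0 (fun j => 0 < c j) (fun j => u j / c j) cj0).
  move=> j cj jmin; exists (u j / c j) => i; case: (ltgtP (c i) 0) => [ci|ci|ci].
  - by rewrite noneg in ci.
  - by rewrite mulrC -ler_pdivlMr //; exact: jmin.
  - by rewrite ci mul0r u0.
exists 0 => i; rewrite mulr0 u0 //.
by case: (ltgtP (c i) 0) => // ci; [have := noneg i|have := nopos i]; rewrite ci.
Qed.

(** Multiplier of inequality [k] in inequality [z] of the eliminated system. Indices of the wrong
    sign get the zero row, so the index type stays plainly [I + I * I]. *)
Definition fm_weight (I : finType) (c : I -> R) (z : I + I * I) (k : I) : R :=
  match z with
  | inl i => ((k == i) && (c i == 0))%:R
  | inr (i, j) =>
      if (0 < c i) && (c j < 0) then c i * (k == j)%:R - c j * (k == i)%:R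
      else 0
  end.

Lemma sum_delta (I : finType) (f : I -> R) i : \sum_k (k == i)%:R * f k = f i.
Proof.
rewrite (bigD1 i) //= eqxx mul1r big1 ?addr0 // => k /negPf ->.
by rewrite mul0r.
Qed.

Lemma fm_weight_ge0 (I : finType) (c : I -> R) z k : 0 <= fm_weight c z k.
Proof.
case: z => [i|[i j]] /=; first by rewrite ler0n.
case: ifP => // /andP[ci cj].
by rewrite -mulNr addr_ge0 // mulr_ge0 ?ler0n // ?oppr_ge0 ltW.
Qed.

Lemma sum_fm_weight_inl (I : finType) (c f : I -> R) i :
  \sum_k fm_weight c (inl i) k * f k = (c i == 0)%:R * f i.
Proof.
rewrite -(sum_delta (fun k => (c i == 0)%:R * f k)).
by apply: eq_bigr => k _ /=; rewrite mulrA -natrM mulnb.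
Qed.

Lemma sum_fm_weight_inr (I : finType) (c f : I -> R) i j :
  \sum_k fm_weight c (inr (i, j)) k * f k =
  if (0 < c i) && (c j < 0) then c i * f j - c j * f i else 0.
Proof.
rewrite /=; case: ifP => _; last by rewrite big1 // => k _; rewrite mul0r.
rewrite -(sum_delta f j) -(sum_delta f i) !mulr_sumr -sumrB.
by apply: eq_bigr => k _; ring.
Qed.

(** Induction on the number of variables, with [I] general because elimination changes it. A
    solution of the reduced system extends by one coordinate; a certificate pulls back through the
    weights. *)
Lemma farkas_fin (n : nat) (I : finType) (a : I -> 'I_n -> R) (b : I -> R) :
  (exists x : 'I_n -> R, forall i, \sum_k a i k * x k <= b i) \/
  (exists l : I -> R, [/\ forall i, 0 <= l i,
     forall k, \sum_i l i * a i k = 0 & \sum_i l i * b i < 0]).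
Proof.
elim: n I a b => [|n IHn] I a b.
  case: (pickP (fun i => b i < 0)) => [i bi|bge0].
    right; exists (fun k => (k == i)%:R); split=> [k|[]//|].
    - by rewrite ler0n.
    - by rewrite sum_delta.
  by left; exists (fun=> 0) => i; rewrite big_ord0 leNgt bge0.
pose c i := a i ord0; pose T := fm_weight c.
have [[x xP]|[l [l0 la lb]]] := IHn _
    (fun z k => \sum_i T z i * a i (lift ord0 k)) (fun z => \sum_i T z i * b i).
  (* [u i] is what inequality [i] leaves for the eliminated variable; the reduced system gives [u]
     the hypotheses of [linear_system_1var]. *)
  left; pose u i := b i - \sum_k a i (lift ord0 k) * x k.
  have Tu z : 0 <= \sum_i T z i * u i.
    have := xP z; rewrite -subr_ge0; congr (_ <= _).
    under [in RHS]eq_bigr do rewrite mulrBr.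
    rewrite sumrB; congr (_ - _).
    under eq_bigr do rewrite mulr_suml.
    rewrite exchange_big; apply: eq_bigr => i _.
    by rewrite mulr_sumr; apply: eq_bigr => k _; rewrite mulrA.
  have [i ci|i j ci cj|t tP] := @linear_system_1var I c u.
  - by have := Tu (inl i); rewrite sum_fm_weight_inl ci eqxx mul1r.
  - by have := Tu (inr (i, j)); rewrite sum_fm_weight_inr ci cj.
  exists (fun k => if unlift ord0 k is Some k' then x k' else t) => i.
  rewrite big_ord_recl unlift_none.
  under eq_bigr do rewrite liftK.
  by rewrite -lerBrDr tP.
have swap (f : I -> R) :
    \sum_i (\sum_z l z * T z i) * f i = \sum_z l z * \sum_i T z i * f i.
  under eq_bigr do rewrite mulr_suml.
  rewrite exchange_big; apply: eq_bigr => z _.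
  by rewrite mulr_sumr; apply: eq_bigr => i _; rewrite mulrA.
right; exists (fun i => \sum_z l z * T z i); split=> [i|k|].
- by apply: sumr_ge0 => z _; rewrite mulr_ge0 // fm_weight_ge0.
- case: (unliftP ord0 k) => [k' ->|->]; first by rewrite swap la.
  (* Column [ord0] vanishes because every row of [T] annihilates [c]. *)
  rewrite swap big1 // => -[i|[i j]] _.
    rewrite sum_fm_weight_inl -/(c i).
    by case: eqP => [->|_]; rewrite ?mulr0 ?mul0r ?mulr0.
  rewrite sum_fm_weight_inr -/(c i) -/(c j) mulrC; case: ifP => _; last by rewrite mul0r.
  by rewrite [c j * c i]mulrC subrr mul0r.
- by rewrite swap.
Qed.

(** * Dot products, entrywise order, and Farkas' lemma in matrix form *)

Lemma dotpE p (u v : 'cV[R]_p) : dotp u v = \sum_i u i 0 * v i 0.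
Proof. by rewrite /dotp mxE; apply: eq_bigr => i _; rewrite mxE. Qed.

Lemma dotpC p (u v : 'cV[R]_p) : dotp u v = dotp v u.
Proof. by rewrite !dotpE; apply: eq_bigr => i _; rewrite mulrC. Qed.

Lemma dotpDr p (u v w : 'cV[R]_p) : dotp u (v + w) = dotp u v + dotp u w.
Proof. by rewrite /dotp mulmxDr mxE. Qed.

Lemma dotpZr p (u v : 'cV[R]_p) t : dotp u (t *: v) = t * dotp u v.
Proof. by rewrite /dotp -scalemxAr mxE. Qed.

Lemma dotpNr p (u v : 'cV[R]_p) : dotp u (- v) = - dotp u v.
Proof. by rewrite /dotp mulmxN mxE. Qed.

Lemma dotp_scalar (s t : R) : dotp s%:M t%:M = s * t.
Proof. by rewrite dotpE big_ord1 !mxE !mulr1n. Qed.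

Lemma dotp_col_mx p q (u u' : 'cV[R]_p) (v v' : 'cV[R]_q) :
  dotp (col_mx u v) (col_mx u' v') = dotp u u' + dotp v v'.
Proof. by rewrite /dotp tr_col_mx mul_row_col mxE. Qed.

Lemma dotp_mulmx p q (M : 'M[R]_(p, q)) u v :
  dotp u (M *m v) = dotp (M^T *m u) v.
Proof. by rewrite /dotp trmx_mul trmxK mulmxA. Qed.

Lemma ler_dotp p (u v w : 'cV[R]_p) :
  mxle 0 u -> mxle v w -> dotp u v <= dotp u w.
Proof.
move=> u0 vw; rewrite !dotpE; apply: ler_sum => i _; apply: ler_wpM2l => //.
by have := u0 i 0; rewrite mxE.
Qed.

Lemma mxle_mulmxr p q r (M N : 'M[R]_(p, q)) (U : 'M[R]_(q, r)) :
  mxle M N -> mxle 0 U -> mxle (M *m U) (N *m U).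
Proof.
move=> MN U0 i j; rewrite !mxE; apply: ler_sum => k _; apply: ler_wpM2r => //.
by have := U0 k j; rewrite mxE.
Qed.

Lemma mxle_col_mx p q r (U U' : 'M[R]_(p, r)) (V V' : 'M[R]_(q, r)) :
  mxle (col_mx U V) (col_mx U' V') <-> mxle U U' /\ mxle V V'.
Proof.
split=> [h|[hU hV] i j]; last first.
  by rewrite -(splitK i); case: (split i) => k; rewrite ?col_mxEu ?col_mxEd.
split=> i j; first by have := h (lshift _ i) j; rewrite !col_mxEu.
by have := h (rshift _ i) j; rewrite !col_mxEd.
Qed.

(** The constraints [x >= 0] become rows [- x j <= 0] of a free system; their multipliers are
    exactly the entries of [A^T *m l]. *)
Lemma farkas p q (A : 'M[R]_(p, q)) (b : 'cV[R]_p) :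
  (exists2 x : 'cV[R]_q, mxle 0 x & mxle (A *m x) b) \/
  (exists l : 'cV[R]_p, [/\ mxle 0 l, mxle 0 (A^T *m l) & dotp l b < 0]).
Proof.
pose a (z : 'I_p + 'I_q) k :=
  match z with inl i => A i k | inr j => - (j == k)%:R end.
have [[x xP]|[l [l0 la lb]]] :=
    farkas_fin a (fun z => if z is inl i then b i 0 else 0).
  left; exists (\col_k x k) => i j; rewrite ?(ord1 j) !mxE.
    have := xP (inr i); rewrite /= -[x i](sum_delta x) -oppr_le0 -sumrN.
    by congr (_ <= _); apply: eq_bigr => k _; rewrite eq_sym mulNr.
  have := xP (inl i); congr (_ <= _); apply: eq_bigr => k _.
  by rewrite mxE.
right; exists (\col_i l (inl i)); split=> [i j|k j|].
- by rewrite !mxE.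
- have := la k; rewrite big_sumType /=.
  rewrite [X in _ + X](_ : _ = - l (inr k)); last first.
    rewrite -(sum_delta (fun j => l (inr j))) -sumrN.
    by apply: eq_bigr => i _; rewrite mulrN mulrC.
  move=> /eqP; rewrite subr_eq0 => /eqP e.
  rewrite !mxE (_ : \sum__ _ = l (inr k)) // -e.
  by apply: eq_bigr => i _; rewrite !mxE mulrC.
- move: lb; rewrite big_sumType /= [X in _ + X]big1 ?addr0; last first.
    by move=> i _; rewrite mulr0.
  by congr (_ < _); rewrite dotpE; apply: eq_bigr => i _; rewrite mxE.
Qed.

(** * Linear programming: dual solutions and attained maxima *)

Section LinearProgram.
Variables (p q : nat) (A : 'M[R]_(p, q)) (b : 'cV[R]_p) (w : 'cV[R]_q).
Variables (h0 : 'cV[R]_q) (v : R).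
Hypotheses (h0_ge0 : mxle 0 h0) (Ah0_le : mxle (A *m h0) b).
Hypothesis lp_ub : forall h, mxle 0 h -> mxle (A *m h) b -> dotp w h <= v.

(* If the dual system is infeasible, its Farkas certificate [(z, t)] gives the
   primal feasible point [(h0 + z) / (1 + t)]; adding [h0] avoids treating
   [t = 0] apart, provided [v] is attained at [h0]. *)
Lemma lp_dual_solution : dotp w h0 = v ->
  exists y : 'cV[R]_p, [/\ mxle 0 y, mxle w (A^T *m y) & dotp b y <= v].
Proof.
move=> wh0.
have [[y y0]|[l [l0 lA lb]]] :=
    farkas (col_mx (- A^T) b^T) (col_mx (- w) (v%:M : 'cV_1)).
  rewrite mul_col_mx mxle_col_mx => -[Ay /(_ 0 0) by_le]; exists y; split=> //.
    by move=> i j; have := Ay i j; rewrite mulNmx !mxE lerN2.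
  by move: by_le; rewrite [leRHS]mxE eqxx mulr1n.
move: l0 lA lb; rewrite -[l]vsubmxK; set z := usubmx l.
rewrite [dsubmx l]mx11_scalar; set t := dsubmx l 0 0.
rewrite -[X in mxle X (col_mx _ _)]vsubmxK mxle_col_mx => -[z0 t0].
have {}z0 : mxle 0 z by move=> i j; have := z0 i j; rewrite !mxE.
have {}t0 : 0 <= t by have := t0 0 0; rewrite !mxE.
rewrite tr_col_mx linearN /= !trmxK mul_row_col mulNmx mul_mx_scalar.
move=> Az; rewrite dotp_col_mx dotp_scalar dotpNr => lt0.
have t1 : 0 < 1 + t by rewrite ltr_wpDr.
have := @lp_ub ((1 + t)^-1 *: (h0 + z)); rewrite dotpZr dotpDr wh0.
rewrite mulrC ler_pdivrMr // => lub; move: lt0; rewrite ltNge => /negP[].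
suff: v + dotp w z <= v * (1 + t) by rewrite (dotpC z); lra.
apply: lub => i j; rewrite (ord1 j).
  have := h0_ge0 i 0; have := z0 i 0; rewrite !mxE => zi hi.
  by rewrite mulr_ge0 ?addr_ge0 // invr_ge0 ltW.
have := Ah0_le i 0; have := Az i 0.
rewrite -scalemxAr mulmxDr !mxE => zi hi.
by rewrite mulrC ler_pdivrMr //; lra.
Qed.

(** If no feasible [h] reaches [sup S], a Farkas certificate [(z, t)] yields
    [t * dotp w h <= dotp z b < t * sup S] for all feasible [h]. Dividing by [t > 0] gives an upper
    bound below the supremum, while [t = 0] fails at [h0]. *)
Lemma lp_max_attained :
  exists v', is_max [set dotp w h | h in
    [set h | mxle 0 h /\ mxle (A *m h) b]] v'.
Proof.
set S := (X in is_max X).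
have S0 : S (dotp w h0) by exists h0.
have Sub : ubound S v by move=> _ [h [h_ge0 Ah] <-]; exact: lp_ub.
have Ssup : has_sup S by split; [exists (dotp w h0)|exists v].
exists (sup S); split; last exact: sup_upper_bound.
have [[h h_ge0]|[l [l0 lA lb]]] :=
    farkas (col_mx A (- w^T)) (col_mx b ((- sup S)%:M : 'cV_1)).
  rewrite mul_col_mx mxle_col_mx => -[Ah /(_ 0 0)].
  rewrite mulNmx [leLHS]mxE [leRHS]mxE eqxx mulr1n lerN2 => sup_le.
  exists h => //; apply/eqP; rewrite eq_le sup_le andbT.
  by apply: sup_upper_bound => //; exists h.
move: l0 lA lb; rewrite -[l]vsubmxK; set z := usubmx l.
rewrite [dsubmx l]mx11_scalar; set t := dsubmx l 0 0.
rewrite -[X in mxle X (col_mx _ _)]vsubmxK mxle_col_mx => -[z0 t0].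
have {}z0 : mxle 0 z by move=> i j; have := z0 i j; rewrite !mxE.
have {}t0 : 0 <= t by have := t0 0 0; rewrite !mxE.
rewrite tr_col_mx linearN /= !trmxK mul_row_col mulNmx mul_mx_scalar.
move=> Az; rewrite dotp_col_mx dotp_scalar => lt0.
have tS h : mxle 0 h -> mxle (A *m h) b -> t * dotp w h <= dotp z b.
  move=> h_ge0 Ah; apply: le_trans (ler_dotp z0 Ah).
  rewrite dotp_mulmx [dotp w h]dotpC -dotpZr [leRHS]dotpC; apply: ler_dotp => // i j.
  by have := Az i j; rewrite !mxE subr_ge0.
have zb_lt : dotp z b < t * sup S by lra.
have [t_gt0|t_le0] := ltP 0 t; last first.
  have t_eq0 : t = 0 by apply/eqP; rewrite eq_le t_le0 t0.
  by have := tS _ h0_ge0 Ah0_le; rewrite t_eq0 in zb_lt *; lra.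
have : sup S <= dotp z b / t.
  apply: ge_sup; first by exists (dotp w h0).
  move=> _ [h [h_ge0 Ah] <-]; rewrite ler_pdivlMr // mulrC.
  exact: tS.
by rewrite ler_pdivlMr // mulrC leNgt zb_lt.
Qed.

End LinearProgram.
End Farkas.

Theorem mainTheorem4 (R : realType) (m n n' L : nat)
    (P : ar_instance R m n n' L)
    (hA : forall x : 'cV[R]_n', ar_X P x -> mxle 0 (ar_A P *m x))
    (theta gamma : 'I_m -> R)
    (htheta : is_theta P theta) (hgamma : is_gamma P gamma)
    (xs : 'cV[R]_n') (ys : 'cV[R]_n) (alphas : 'cV[R]_L) (zLPAR : R)
    (hopt : lpar_optimal P theta gamma xs ys alphas)
    (hz : is_lpar_value P theta gamma zLPAR) :
  exists (M : 'M[R]_(n, m)) (q : 'cV[R]_n),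
    affine_feasible P xs M q /\
    exists w : R, is_worst_case_cost P xs M q w /\ w <= zLPAR.
Proof.
have [[feas Xxs ys0 al0] [_ optlb]] := hopt.
have obj_le : lpar_objective P xs ys alphas <= zLPAR by apply: optlb; exact: hz.1.
have hgammaP i h : uncertainty_set P h -> h i 0 <= gamma i.
  by move=> Uh; apply: (hgamma i).2; exists h.
have U0 : uncertainty_set P 0.
  by split=> // i j; rewrite mulmx0 mxE; have := ar_r_ge0 P i j; rewrite mxE.
have gamma0 i : 0 <= gamma i by have := hgammaP i _ U0; rewrite mxE.
(* The program defining [theta i] has matrix [B^T], right-hand side [d] and objective [e_i]; [v] is
   its dual solution. *)
have cover i : exists v : 'cV[R]_n,
    [/\ mxle 0 v, mxle (delta_mx i 0) (ar_B P *m v) & dotp (ar_d P) v <= theta i].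
  have [[z0 [Bz0 z0_ge0] z0i] ub] := htheta i.
  have dotp_delta (u : 'cV[R]_m) : dotp (delta_mx i 0) u = u i 0.
    rewrite dotpE -[RHS](sum_delta (fun k => u k 0)).
    by apply: eq_bigr => k _; rewrite mxE andbT.
  have [||v [v0 Bv dv]] :=
      lp_dual_solution z0_ge0 Bz0 (w := delta_mx i 0) (v := theta i).
  - by move=> h h_ge0 Bh; rewrite dotp_delta; apply: ub; exists h.
  - by rewrite dotp_delta.
  by exists v; split=> //; move: Bv; rewrite trmxK.
have {cover} [V VP] := choice cover.
pose s := ar_A P *m xs + ar_B P *m ys.
have sE i : dotp (row i (ar_A P))^T xs + dotp (row i (ar_B P))^T ys = s i 0.
  by rewrite /dotp !trmxK -!row_mul !mxE.
(* The assumption [A x >= 0] on the cone enters here. *)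
have s0 i : 0 <= s i 0.
  have := hA _ Xxs i 0; rewrite mxE => Ai; rewrite mxE addr_ge0 //.
  rewrite mxE; apply: sumr_ge0 => k _.
  by have := ar_B_ge0 P i k; have := ys0 k 0; rewrite !mxE => ? ?; exact: mulr_ge0.
(* When [gamma i = 0] the quotient is the junk value [0] and [beta i = 1],
   which is harmless because then [h i = 0] on the uncertainty set. *)
pose beta i := Num.max 0 (1 - s i 0 / gamma i).
have beta0 i : 0 <= beta i by rewrite le_max lexx.
pose W : 'M[R]_(n, m) := \matrix_(k, i) V i k 0.
have W0 : mxle 0 W.
  by move=> k i; have [/(_ k 0)] := VP i; rewrite !mxE.
have BW : mxle 1%:M (ar_B P *m W).
  move=> j i; have [_ /(_ j 0) + _] := VP i; rewrite !mxE andbT.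
  by congr (_ <= _); apply: eq_bigr => k _; rewrite mxE.
have dW i : (W^T *m ar_d P) i 0 <= theta i.
  have [_ _] := VP i; rewrite dotpE mxE; congr (_ <= _).
  by apply: eq_bigr => k _; rewrite !mxE mulrC.
(* [g h] is the share of the demand [h] that the linear part of the policy covers, since
   [B W >= 1]. *)
pose g (h : 'cV[R]_m) : 'cV[R]_m := \col_i (beta i * h i 0).
pose M := W *m diag_mx (\row_i beta i).
have ME h : M *m h = W *m g h.
  rewrite -mulmxA; congr (_ *m _); apply/matrixP => i j.
  by rewrite (ord1 j) mul_diag_mx !mxE.
have g0 h : uncertainty_set P h -> mxle 0 (g h).
  move=> [h0 _] i j; rewrite !mxE mulr_ge0 //.
  by have := h0 i 0; rewrite mxE.
have cost h : uncertainty_set P h ->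
    dotp (ar_d P) (affine_map M ys h) <= dotp (ar_d P) ys + dotp (ar_r P) alphas.
  move=> Uh; have [h0 Rh] := Uh.
  rewrite /affine_map dotpDr addrC lerD2l ME dotp_mulmx.
  (* Passing through [alphas^T R h] reduces the bound to one comparison per coordinate of [h]. *)
  rewrite [leRHS]dotpC; apply: le_trans (ler_dotp al0 Rh).
  rewrite [leRHS]dotp_mulmx !dotpE; apply: ler_sum => i _; rewrite [g h i 0]mxE mulrA.
  have hi0 : 0 <= h i 0 by have := h0 i 0; rewrite mxE.
  have [gi|gi] := ltP 0 (gamma i); last first.
    suff -> : h i 0 = 0 by rewrite !mulr0.
    by apply/le_anti; rewrite hi0 (le_trans (hgammaP i h Uh)).
  apply: ler_wpM2r => //.
  apply: (le_trans (ler_wpM2r (beta0 i) (dW i))).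
  have := feas i; rewrite -mulrDr sE.
  have -> : dotp (col i (ar_R P)) alphas = ((ar_R P)^T *m alphas) i 0.
    by rewrite /dotp tr_col -row_mul mxE.
  set Ra := ((ar_R P)^T *m alphas) i 0 => fi.
  have Ra0 : 0 <= Ra.
    rewrite /Ra mxE; apply: sumr_ge0 => k _; rewrite mxE.
    by have := ar_R_ge0 P k i; have := al0 k 0; rewrite !mxE => ? ?; exact: mulr_ge0.
  rewrite /beta maxEle; case: ifP => _; last by rewrite mulr0.
  (* Multiplying by [gamma i] clears the quotient in [beta i] and leaves the (LP-AR) constraint of
     row [i]. *)
  rewrite -(ler_pM2l gi).
  rewrite [leLHS](_ : _ = theta i * gamma i - theta i * s i 0); first by lra.
  by field; rewrite gt_eqF.
(* Only the linear part of the cost is maximised, with objective [M^T d]; the constant [d^T ys] is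
   added back at the end. *)
have [v [[h Uh hv] vub]] :=
  lp_max_attained U0.1 U0.2 (w := M^T *m ar_d P)
    (v := dotp (ar_r P) alphas)
    (fun h h0 Rh => ltac:(have := cost h (conj h0 Rh);
       rewrite /affine_map dotpDr dotp_mulmx addrC lerD2l; exact)).
exists M, ys; split.
  split=> // h' Uh'; split=> i j; rewrite (ord1 j).
    rewrite /affine_map ME mxE [leRHS]mxE addr_ge0 //.
    + rewrite mxE; apply: sumr_ge0 => k _.
      have := W0 i k; have := g0 _ Uh' k 0.
      by rewrite [X in X <= _ -> _]mxE [X in _ -> X <= _ -> _]mxE => ? ?; exact: mulr_ge0.
    + by have := ys0 i 0; rewrite mxE.
  rewrite /affine_map mulmxDr ME mulmxA addrCA [leRHS]mxE -/s addrC.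
  have := mxle_mulmxr BW (g0 _ Uh') i 0; rewrite mul1mx => gi_le.
  apply: (@le_trans _ _ (s i 0 + g h' i 0)); last by rewrite lerD2l.
  have hi0 : 0 <= h' i 0 by have := Uh'.1 i 0; rewrite mxE.
  have [gi|gi] := ltP 0 (gamma i); last first.
    by rewrite [g h' i 0]mxE (le_trans (hgammaP i h' Uh')) // (le_trans gi) //
       addr_ge0 ?mulr_ge0.
  rewrite [g h' i 0]mxE.
  have b1 : 1 - s i 0 / gamma i <= beta i by rewrite le_max lexx orbT.
  (* The middle term is [h_i + s_i (1 - h_i / gamma_i)], at least [h_i] because [h_i <= gamma_i] and
     [s_i >= 0]. *)
  apply: le_trans (_ : s i 0 + (1 - s i 0 / gamma i) * h' i 0 <= _); last first.
    by rewrite lerD2l ler_wpM2r.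
  have : s i 0 / gamma i * h' i 0 <= s i 0.
    by rewrite mulrAC ler_pdivrMr // ler_wpM2l // hgammaP.
  by lra.
exists (dotp (ar_c P) xs + (v + dotp (ar_d P) ys)); split.
  exists (v + dotp (ar_d P) ys); split=> //; split.
    by exists h => //; rewrite /affine_map dotpDr dotp_mulmx hv.
  move=> _ [h' Uh' <-]; rewrite /affine_map dotpDr dotp_mulmx lerD2r.
  by apply: vub; exists h'.
apply: le_trans obj_le; rewrite /lpar_objective -addrA lerD2l.
by have := cost h Uh; rewrite /affine_map dotpDr dotp_mulmx hv.
Qed.
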